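(* Let $U^n$, $n=2,\dots,N$, be the solution of the variable step-size BDF2 scheme $\bar\partial_B^2U^n+AU^n+BU^n=f^n$ ($n=2,\dots,N$) with starting approximations $U^0,U^1$, where $f:[0,T]\to H$. Let $r_{\max}\le R$ with $1<R<R_1=\frac{3+\sqrt{17}}2$, and let $c_R>\max\big\{\frac{2+2R}{2+R},\frac{2+2R}{2+3R-R^2}\big\}$. If there exists a constant $c_1\in(0,1)$ such that $k_{\max}$ satisfies $$c_R\gamma^2k_{\max}\le c_1<1,$$ then, for any $n\ge2$ (with $n\le N$), $$\frac{R}{1+R}k_n|\bar\partial U^n|^2+\|U^n\|^2\le C_2\Big(\frac R{1+R}k_1|\bar\partial U^1|^2+\|U^1\|^2+c_R\sum_{j=2}^nk_j|f^j|^2\Big)$$ and $$\sum_{j=2}^nk_j\|U^j\|^2\le C_2t^n\Big(k_1|\bar\partial U^1|^2+\|U^1\|^2+c_R\sum_{j=2}^nk_j|f^j|^2\Big),$$ where $$C_2=\frac{c_R}{1-c_1}\exp\Big(\frac{c_R}{1-c_1}\sum_{j=2}^n\gamma^2(t^j)k_j\Big)\le\frac{c_R}{1-c_1}\exp\Big(\frac{c_R}{1-c_1}\gamma^2t^n\Big).$$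
   Context: Let $(H,(\cdot,\cdot))$ be a Hilbert space with norm $|\cdot|$, and $A:D(A)\to H$ a positive definite, self-adjoint, linear operator with $D(A)$ dense in $H$. Let $V=D(A^{1/2})$ with norm $\|v\|=|A^{1/2}v|=(Av,v)^{1/2}$, and let $V^*$ be its dual, $V\subset H\subset V^*$, with norm $\|v\|_*=|A^{-1/2}v|$; $(\cdot,\cdot)$ also denotes the duality pairing between $V^*$ and $V$. $B$ is a linear operator with $|Bu|\le\gamma(t)\|u\|$ for all $u\in V$, $t\in J:=(0,T]$, where $\gamma:J\to\mathbb R$ is a smooth nonnegative function, and (without argument) $\gamma:=\max_{t\in J}\gamma(t)$. The underlying problem is $u'(t)+Au(t)+Bu(t)=f(t)$, $t\in J$, $u(0)=u^0$. Partition: $N\ge2$, $0=t^0<t^1<\dots<t^N=T$, $k_n=t^n-t^{n-1}$, $r_n=k_n/k_{n-1}$ and $s_n=r_n/(1+r_n)=k_n/(k_n+k_{n-1})$ for $n\ge2$; $k_{\max}=\max_{2\le n\le N}k_n$, $r_{\max}=\max_{2\le n\le N}r_n$; $f^n=f(t^n)$. Difference operators: $\bar\partial U^n=(U^n-U^{n-1})/k_n$ and $\bar\partial_B^2U^n=(1+s_n)\bar\partial U^n-s_n\bar\partial U^{n-1}$. The scheme is understood in variational form: $(\bar\partial_B^2U^n,v)+(AU^n,v)+(BU^n,v)=(f^n,v)$ for all $v\in V$, with $U^n\in V$; starting approximations $U^0\in H$, $U^1\in V$ are given. *)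

(* Defs.v *)
From mathcomp Require Import all_boot all_order all_algebra.
From mathcomp Require Import all_classical all_reals all_analysis.
Import Order.TTheory GRing.Theory Num.Theory.
Import numFieldNormedType.Exports.

Set Implicit Arguments.
Unset Strict Implicit.
Unset Printing Implicit Defensive.

Local Open Scope classical_set_scope.
Local Open Scope ring_scope.

(* A real Hilbert space is a complete normed space H together with a positive
   definite symmetric bilinear form that induces its norm. *)
Definition induces_norm (K : realType) (H : completeNormedModType K)
    (ip : {dot H for idfun}) : Prop :=
  forall u : H, ip u u = `|u| ^+ 2.

(* Possibly unbounded linear operators; the values of [opfun] outside [dom]
   carry no meaning. *)
Record loperator (K : realType) (H : lmodType K) := LOperator {
  dom : set H;
  opfun :> H -> H;
  dom0 : dom 0;
  domP : forall (a : K) (u v : H), dom u -> dom v -> dom (a *: u + v);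
  opfunP : forall (a : K) (u v : H), dom u -> dom v ->
    opfun (a *: u + v) = a *: opfun u + opfun v
}.

Section Operators.
Context (K : realType) (H : completeNormedModType K) (ip : {dot H for idfun}).
Implicit Types A S : loperator H.

(* (v, w) belongs to the graph of the adjoint of A. *)
Definition adjoint_graph A (v w : H) : Prop :=
  forall u, dom A u -> ip (A u) v = ip u w.

Definition self_adjoint A : Prop :=
  dense (dom A) /\
  forall v w, adjoint_graph A v w <-> dom A v /\ A v = w.

Definition positive_definite A : Prop :=
  forall u, dom A u -> u != 0 -> 0 < ip (A u) u.

Definition nonnegative A : Prop := forall u, dom A u -> 0 <= ip (A u) u.

(* S = A^(1/2), the nonnegative self-adjoint operator with S o S = A, where
   D(S o S) consists of the u in D(S) with S u in D(S). *)
Definition is_sqrt_op S A : Prop :=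
  [/\ self_adjoint S, nonnegative S &
      forall u w, (dom A u /\ A u = w) <->
                  [/\ dom S u, dom S (S u) & S (S u) = w]].

(* V = D(A^(1/2)) and its norm, in terms of S = A^(1/2). *)
Definition Vspace S : set H := dom S.
Definition Vnorm S (v : H) : K := `|S v|.

(* The duality pairing (A u, v) between A u in V^* and v in V, for u in V that
   need not be in D(A): A acts from V to V^* by
   (A u, v) = (A^(1/2) u, A^(1/2) v); see [A_pairingE]. *)
Definition A_pairing S (u v : H) : K := ip (S u) (S v).

Lemma A_pairingE A S : is_sqrt_op S A ->
  forall u v, dom A u -> Vspace S v -> A_pairing S u v = ip (A u) v.
Proof.
move=> [[_ Ssa] _ SA] u v Au Sv.
have [Su SSu <-] := (SA u (A u)).1 (conj Au erefl).
by rewrite ((Ssa v (S v)).2 (conj Sv erefl) _ SSu).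
Qed.

End Operators.

(* gamma is the restriction to J of a function that is infinitely
   differentiable on an open neighbourhood of J. *)
Definition smooth_on (K : realType) (J : set K) (gamma : K -> K) : Prop :=
  exists g : K -> K, exists O : set K,
    [/\ open O, J `<=` O, (forall x, J x -> g x = gamma x) &
        forall n x, O x -> derivable (derive1n n (g : K -> K^o)) x 1].

Definition is_max_on (K : realType) (J : set K) (gamma : K -> K) (m : K) :
    Prop :=
  (gamma @` J) m /\ ubound (gamma @` J) m.

Definition time_grid (K : realType) (N : nat) (T : K) (t : nat -> K) : Prop :=
  [/\ t 0%N = 0, t N = T & forall n, (n < N)%N -> t n < t n.+1].

Section Scheme.
Context (K : realType) (t : nat -> K).

(* k_n, meant for n >= 1. *)
Definition step (n : nat) : K := t n - t n.-1.

(* r_n and s_n, meant for n >= 2. *)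
Definition ratio (n : nat) : K := step n / step n.-1.
Definition sratio (n : nat) : K := ratio n / (1 + ratio n).

(* The default value is the term of index 2, so these are the maxima over
   2 <= n <= N as soon as 2 <= N. *)
Definition max_step (N : nat) : K :=
  \big[Num.max/step 2]_(2 <= n < N.+1) step n.
Definition max_ratio (N : nat) : K :=
  \big[Num.max/ratio 2]_(2 <= n < N.+1) ratio n.

Context (H : completeNormedModType K).

Definition bdiff (U : nat -> H) (n : nat) : H :=
  (step n)^-1 *: (U n - U n.-1).

Definition bdf2 (U : nat -> H) (n : nat) : H :=
  (1 + sratio n) *: bdiff U n - sratio n *: bdiff U n.-1.

(* U^0 is only required to lie in H, the later approximations in V. *)
Definition bdf2_solution (ip : {dot H for idfun}) (S B : loperator H)
    (f : K -> H) (N : nat) (U : nat -> H) : Prop :=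
  (forall n, (1 <= n <= N)%N -> Vspace S (U n)) /\
  (forall n, (2 <= n <= N)%N -> forall v, Vspace S v ->
     ip (bdf2 U n) v + A_pairing ip S (U n) v + ip (B (U n)) v
     = ip (f (t n)) v).

Definition stab_const (cR c1 : K) (gamma : K -> K) (n : nat) : K :=
  cR / (1 - c1) *
  expR (cR / (1 - c1) * \sum_(2 <= j < n.+1) gamma (t j) ^+ 2 * step j).

End Scheme.

(* Main.v *)
(* Test the scheme at step n with the difference quotient d_n of U, and estimate
   2 s_n (d_{n-1}, d_n) by Young's inequality with weight r_n:
     2 s_n (d_{n-1}, d_n) <= s_n r_n |d_n|^2 + s_n / r_n |d_{n-1}|^2.
   Since k_n s_n / r_n = k_{n-1} s_n <= k_{n-1} R / (1 + R), the last term is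
   absorbed by the energy E_{n-1} = R/(1+R) k_{n-1} |d_{n-1}|^2 + ||U^{n-1}||^2,
   and the coefficient 2 + 2 s_n - s_n r_n of k_n |d_n|^2 exceeds R/(1+R) by at
   least 2 / c_R, exactly what is needed to absorb f^n and B U^n.  Hence
     E_n <= E_{n-1} + c_R k_n |f^n|^2 + c_R gamma(t^n)^2 k_n E_n,
   and the discrete Gronwall inequality gives both bounds. *)
Require Import Defs.
From mathcomp Require Import all_boot all_order all_algebra.
From mathcomp Require Import all_classical all_reals all_analysis.
From mathcomp Require Import ring lra.
Import Order.TTheory GRing.Theory Num.Theory.
Import numFieldNormedType.Exports.
Local Open Scope classical_set_scope.
Local Open Scope ring_scope.

Set Implicit Arguments.
Unset Strict Implicit.
Unset Printing Implicit Defensive.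

(** * Identities for the inner product and Young's inequality *)

Section InnerProduct.
Context (K : realType) (H : completeNormedModType K) (ip : {dot H for idfun}).

Lemma ipC u v : ip u v = ip v u.
Proof. by rewrite hermC /= expr0 mul1r. Qed.

Lemma ipBl u v w : ip (u - v) w = ip u w - ip v w.
Proof. exact: linearBl. Qed.

Lemma ipNl u v : ip (- u) v = - ip u v.
Proof. exact: linearNl. Qed.

Lemma ipZl (a : K) u v : ip (a *: u) v = a * ip u v.
Proof. exact: linearZl_LR. Qed.

Lemma ipZr (a : K) u v : ip u (a *: v) = a * ip u v.
Proof. exact: linearZr_LR. Qed.

Lemma ip_normB : induces_norm ip -> forall u v,
  `|u - v| ^+ 2 = `|u| ^+ 2 - 2 * ip u v + `|v| ^+ 2.
Proof.
move=> ip_norm u v; rewrite -!ip_norm linearBl !linearB /= (ipC v u); ring.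
Qed.

(** Expand |a u - v|^2 >= 0 and divide by [a]. *)
Lemma ip_young : induces_norm ip -> forall (a : K) u v, 0 < a ->
  2 * ip u v <= a * `|u| ^+ 2 + a^-1 * `|v| ^+ 2.
Proof.
move=> ip_norm a u v a_gt0.
have := sqr_ge0 `|a *: u - v|.
rewrite (ip_normB ip_norm) ipZl normrZ exprMn real_normK ?num_real // => h.
rewrite -subr_ge0 -(pmulr_rge0 _ a_gt0).
suff -> : a * (a * `|u| ^+ 2 + a^-1 * `|v| ^+ 2 - 2 * ip u v)
        = a ^+ 2 * `|u| ^+ 2 - 2 * (a * ip u v) + `|v| ^+ 2 by [].
by field; rewrite gt_eqF.
Qed.

End InnerProduct.

(** * Scalar inequalities for the step ratios *)

(** The upper limit for [R] is the positive root: four times the quadratic is 17 - (2 R - 3)^2, a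
    difference of squares. *)
Lemma bdf2_discriminant_gt0 (K : realType) (R : K) :
  1 < R < (3 + Num.sqrt 17) / 2 -> 0 < 2 + 3 * R - R ^+ 2.
Proof.
move=> /andP[R_gt1 R_lt].
have w_sqr : Num.sqrt 17 * Num.sqrt 17 = 17 :> K by rewrite -expr2 sqr_sqrtr.
have w_ge0 : 0 <= Num.sqrt 17 :> K by exact: sqrtr_ge0.
move: (Num.sqrt _) w_sqr w_ge0 R_lt => w *.
have w_ge1 : 1 <= w by nra.
have : 0 < (w - (2 * R - 3)) * (w + (2 * R - 3)) by apply: mulr_gt0; lra.
nra.
Qed.

(** Multiplied by 1 + r, the gap is a concave quadratic in [r], so only the endpoints matter: the
    first term of the maximum settles r = 0, the second r = R. *)
Lemma bdf2_coef_bound (K : realFieldType) (R c r : K) :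
  1 < R -> 0 < 2 + 3 * R - R ^+ 2 -> 0 < r <= R ->
  Num.max ((2 + 2 * R) / (2 + R)) ((2 + 2 * R) / (2 + 3 * R - R ^+ 2)) < c ->
  R / (1 + R) + 2 / c <= 2 + 2 * (r / (1 + r)) - r / (1 + r) * r.
Proof.
move=> R_gt1 D_gt0 /andP[r_gt0 r_le]; rewrite gt_max => /andP[].
rewrite !ltr_pdivrMr; [|lra..] => c1 c2.
have c_gt0 : 0 < c by nra.
set q := R / (1 + R) + 2 / c.
have q0 : q <= 2.
  rewrite /q addf_div ?gt_eqF; [|lra..].
  by rewrite ler_pdivrMr; nra.
have qR : q * (1 + R) <= 2 + 4 * R - R ^+ 2.
  rewrite /q addf_div ?gt_eqF; [|lra..].
  rewrite mulrAC ler_pdivrMr; nra.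
have -> : 2 + 2 * (r / (1 + r)) - r / (1 + r) * r
        = (2 + 4 * r - r ^+ 2) / (1 + r) by field; lra.
rewrite ler_pdivlMr; last lra.
have R_gt0 : 0 < R by lra.
rewrite -subr_ge0 -(pmulr_rge0 _ R_gt0).
(* [2 + 4 r - r^2 - q (1 + r)] is concave in [r], so it dominates its chord. *)
have -> : R * (2 + 4 * r - r ^+ 2 - q * (1 + r))
  = (R - r) * (2 - q) + r * (2 + 4 * R - R ^+ 2 - q * (1 + R))
    + R * r * (R - r) by ring.
rewrite !addr_ge0 ?mulr_ge0 ?subr_ge0 //; lra.
Qed.

Lemma bdf2_sratio_le (K : realFieldType) (R r : K) :
  0 < r <= R -> 0 <= r / (1 + r) <= R / (1 + R).
Proof.
move=> /andP[r_gt0 r_le]; apply/andP; split; first by rewrite divr_ge0; lra.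
rewrite -subr_ge0.
have -> : R / (1 + R) - r / (1 + r) = (R - r) / ((1 + R) * (1 + r)).
  by field; apply/andP; split; lra.
by rewrite divr_ge0 ?mulr_ge0; lra.
Qed.

(* [X], [X'] stand for |d_n|^2, |d_{n-1}|^2, [P] for ||U^n||^2, [Q] for
   ||U^n - U^{n-1}||^2 and [P - 2 * pp + Q] for ||U^{n-1}||^2. *)
Lemma bdf2_energy_arith (K : realFieldType)
    (k k' r s q c G X X' P b2 h2 Q bd hd dd pp : K) :
  0 < k -> 0 < k' -> 0 < r -> 0 <= s -> s <= q -> 0 < c ->
  k = r * k' -> q + 2 / c <= 2 + 2 * s - s * r ->
  (1 + s) * X - s * dd + k^-1 * pp + bd = hd ->
  2 * dd <= r^-1 * X' + r * X ->
  2 * hd <= c * h2 + c^-1 * X ->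
  2 * - bd <= c * b2 + c^-1 * X ->
  b2 <= G * P ->
  0 <= X' -> 0 <= X -> 0 <= Q -> 0 <= G ->
  q * k * X + P <= q * k' * X' + (P - 2 * pp + Q) + c * (k * h2)
                   + c * (G * k) * (q * k * X + P).
Proof.
move=> k_gt0 k'_gt0 r_gt0 s_ge0 s_le c_gt0 kE coef eq young_d young_h young_b.
move=> b_le X'_ge0 X_ge0 Q_ge0 G_ge0.
have q_ge0 := le_trans s_ge0 s_le.
(* The growth of ||U||^2 in this step is 2 pp - Q; the tested scheme is solved for its first
   part. *)
have eq_k : 2 * pp = 2 * k * (hd - bd + s * dd - (1 + s) * X).
  have -> : hd - bd + s * dd - (1 + s) * X = k^-1 * pp by rewrite -eq; ring.
  by field; rewrite gt_eqF.
(* Since k / r = k', the weight of [X'] becomes k' s, which s <= q bounds by the weight in the old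
   energy. *)
have dd_le : k * s * (2 * dd) <= k' * q * X' + k * (s * r) * X.
  apply: (le_trans (ler_wpM2l (mulr_ge0 (ltW k_gt0) s_ge0) young_d)).
  have -> : k * s * (r^-1 * X' + r * X) = k' * s * X' + k * (s * r) * X.
    by rewrite kE; field; rewrite gt_eqF.
  by rewrite lerD2r ler_wpM2r // ler_wpM2l // ltW.
have coef_le := ler_wpM2l (mulr_ge0 (ltW k_gt0) X_ge0) coef.
(* Together these cost (2 / c) k X, exactly the margin in [coef_le]. *)
have hb_le := ler_wpM2l (ltW k_gt0) (lerD young_h young_b).
have b_le3 := ler_wpM2l (mulr_ge0 (ltW k_gt0) (ltW c_gt0)) b_le.
(* The operator term yields only G P; this surplus completes [P] to the full new energy, as
   Gronwall's inequality requires. *)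
have extra_ge0 : 0 <= c * (G * k) * (q * k * X).
  by rewrite !mulr_ge0 // ltW.
rewrite eq_k {young_d young_h young_b b_le coef eq eq_k kE s_le s_ge0 q_ge0
  k_gt0 k'_gt0 r_gt0 c_gt0 X'_ge0 X_ge0 G_ge0}.
lra.
Qed.

(** The new value occurs on both sides, so step j costs a factor 1 / (1 - a j), which a j <= c < 1
    turns into an exponential. *)
Lemma discrete_gronwall (K : realType) (N : nat) (c : K) (E a F : nat -> K) :
  c < 1 ->
  (forall j, (2 <= j <= N)%N ->
     [/\ 0 <= a j <= c, 0 <= F j & E j <= E j.-1 + F j + a j * E j]) ->
  0 <= E 1%N ->
  forall n, (1 <= n <= N)%N ->
  E n <= expR ((1 - c)^-1 * \sum_(2 <= j < n.+1) a j)
         * (E 1%N + \sum_(2 <= j < n.+1) F j).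
Proof.
move=> c_lt1 EaF E1_ge0; elim=> [//|[_ _|n IH nN]].
  by rewrite !big_geq // mulr0 expR0 mul1r addr0.
have {}IH := IH (ltnW nN).
have [/andP[a_ge0 a_le] F_ge0 /= E_le] := EaF n.+2 nN.
rewrite !(big_nat_recr n.+2) //= (mulrDr (1 - c)^-1) expRD addrA.
set s := E 1%N + _ in IH *; set x := expR _ in IH *.
have aF_ge0 j : (2 <= j < n.+2)%N -> 0 <= a j /\ 0 <= F j.
  move=> /andP[j2 jn]; have [|/andP[-> _] ->] // := EaF j.
  by rewrite j2 (leq_trans (ltnW jn)).
have s_ge0 : 0 <= s.
  by rewrite addr_ge0 // big_nat sumr_ge0 // => j /aF_ge0[].
have x_ge1 : 1 <= x.
  rewrite -expR0 ler_expR mulr_ge0 ?invr_ge0 ?subr_ge0 ?(ltW c_lt1) //.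
  by rewrite big_nat sumr_ge0 // => j /aF_ge0[].
(* [1 / (1 - a) = 1 + a / (1 - a) <= exp (a / (1 - c))] *)
have y_ge : 1 <= expR ((1 - c)^-1 * a n.+2) * (1 - a n.+2).
  rewrite -ler_pdivrMr; last lra.
  apply: le_trans (expR_ge1Dx _).
  have -> : 1 / (1 - a n.+2) = 1 + (1 - a n.+2)^-1 * a n.+2 by field; lra.
  by rewrite lerD2l ler_wpM2r // lef_pV2 ?posrE; lra.
move: (expR _) (expR_gt0 ((1 - c)^-1 * a n.+2)) y_ge => y y_gt0 y_ge.
(* As x >= 1, the new source may also be multiplied by [x]. *)
have {}E_le : (1 - a n.+2) * E n.+2 <= x * (s + F n.+2).
  apply: (@le_trans _ _ (E n.+1 + F n.+2)); first lra.
  by rewrite mulrDr lerD // ler_peMl.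
have a'_gt0 : 0 < 1 - a n.+2 by lra.
rewrite mulrAC -(ler_pM2l a'_gt0); apply: (le_trans E_le).
rewrite mulrCA ler_peMr 1?[_ * y]mulrC //.
by rewrite mulr_ge0 ?(addr_ge0 s_ge0) // (le_trans ler01).
Qed.

Section LinearOperators.
Context (K : realType) (H : lmodType K) (S : loperator H).

(** Puts difference quotients in V, which makes them admissible test functions. *)
Lemma dom_scaleB (a : K) (u v : H) :
  dom S u -> dom S v -> dom S (a *: (u - v)).
Proof.
move=> Su Sv; rewrite -[_ *: _]addr0; apply: domP; last exact: dom0.
by rewrite addrC -scaleN1r; exact: domP.
Qed.

Lemma loperator_scaleB (a : K) (u v : H) :
  dom S u -> dom S v -> S (a *: (u - v)) = a *: (S u - S v).
Proof.
move=> Su Sv; have S0 : S 0 = 0.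
  have := opfunP 1 (dom0 S) (dom0 S).
  by rewrite !scale1r addr0 -[LHS]addr0 => /addrI.
rewrite -[_ *: _]addr0 opfunP ?S0 ?addr0; last exact: dom0.
  by rewrite addrC -scaleN1r opfunP // scaleN1r addrC.
by rewrite -[_ - _]scale1r; exact: dom_scaleB.
Qed.

End LinearOperators.

(** * Energy inequality for one step of the scheme *)

Section EnergyEstimate.
Context (K : realType) (H : completeNormedModType K) (ip : {dot H for idfun}).
Context (t : nat -> K) (S : loperator H) (U : nat -> H).

(** The weight R / (1 + R) is the value of s_n at ratio [R], hence a bound for s_n when 0 < r_n <=
    R. *)
Definition bdf2_energy (R : K) (n : nat) : K :=
  R / (1 + R) * step t n * `|bdiff t U n| ^+ 2 + Vnorm S (U n) ^+ 2.

(** Here [b], [h] and [g] stand for B U^n, f(t^n) and gamma(t^n). *)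
Lemma bdf2_energy_step (R c g : K) (b h : H) (n : nat) :
  induces_norm ip ->
  1 < R < (3 + Num.sqrt 17) / 2 ->
  Num.max ((2 + 2 * R) / (2 + R)) ((2 + 2 * R) / (2 + 3 * R - R ^+ 2)) < c ->
  0 < step t n -> 0 < step t n.-1 -> Defs.ratio t n <= R ->
  Vspace S (U n) -> Vspace S (U n.-1) ->
  `|b| <= g * Vnorm S (U n) ->
  (forall v, Vspace S v ->
     ip (bdf2 t U n) v + A_pairing ip S (U n) v + ip b v = ip h v) ->
  bdf2_energy R n <= bdf2_energy R n.-1 + c * (step t n * `|h| ^+ 2)
                     + c * (g ^+ 2 * step t n) * bdf2_energy R n.
Proof.
move=> ip_norm R_bd c_gt k_gt0 k'_gt0 r_le Un Un' b_le sol.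
have D_gt0 := bdf2_discriminant_gt0 R_bd; have /andP[R_gt1 _] := R_bd.
have r_gt0 : 0 < Defs.ratio t n by rewrite divr_gt0.
have coef := bdf2_coef_bound R_gt1 D_gt0 (introT andP (conj r_gt0 r_le)) c_gt.
have c_gt0 : 0 < c.
  apply: le_lt_trans c_gt; rewrite le_max; apply/orP; left.
  by rewrite divr_ge0; lra.
rewrite /bdf2_energy.
have := sol (bdiff t U n) (dom_scaleB _ Un Un').
rewrite /A_pairing {2}/bdiff loperator_scaleB // ipZr /bdf2 /sratio.
move: (bdiff t U n) (bdiff t U n.-1) => d d'.
rewrite ipBl !ipZl /= ip_norm => eq.
(* Writing S U^{n-1} as S U^n minus the increment expresses the old V-norm through the product in
   the tested scheme. *)
have := ip_normB ip_norm (S (U n)) (S (U n) - S (U n.-1)).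
rewrite subKr -/(Vnorm S (U n)) -/(Vnorm S (U n.-1)) => norm_old.
have := @ip_young _ _ ip ip_norm (Defs.ratio t n)^-1 d' d.
rewrite invr_gt0 invrK => /(_ r_gt0) young_d.
have young_h := ip_young ip_norm h d c_gt0.
have := ip_young ip_norm (- b) d c_gt0.
rewrite ipNl normrN /= => young_b.
have b_le2 : `|b| ^+ 2 <= g ^+ 2 * Vnorm S (U n) ^+ 2.
  by rewrite -exprMn ler_pXn2r // nnegrE // (le_trans _ b_le).
have kE : step t n = Defs.ratio t n * step t n.-1 by rewrite divfK ?gt_eqF.
have /andP[s_ge0 s_le] := bdf2_sratio_le (introT andP (conj r_gt0 r_le)).
rewrite norm_old.
exact: (bdf2_energy_arith k_gt0 k'_gt0 r_gt0 s_ge0 s_le c_gt0 kE coef eq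
  young_d young_h young_b b_le2 (sqr_ge0 _) (sqr_ge0 _) (sqr_ge0 _)
  (sqr_ge0 g)).
Qed.

End EnergyEstimate.

Theorem theorem3p2 (K : realType) (H : completeNormedModType K)
    (ip : {dot H for idfun}) (ip_norm : induces_norm ip)
    (A : loperator H) (A_pos : positive_definite ip A)
    (A_sa : self_adjoint ip A)
    (sqrtA : loperator H) (sqrtA_sqrt : is_sqrt_op ip sqrtA A)
    (T : K) (gamma : K -> K) (gmax : K)
    (gamma_smooth : smooth_on `]0, T]%classic gamma)
    (gamma_ge0 : forall t : K, 0 < t <= T -> 0 <= gamma t)
    (gamma_max : is_max_on `]0, T]%classic gamma gmax)
    (B : loperator H) (B_dom : Vspace sqrtA `<=` dom B)
    (B_bound : forall (u : H) (t : K), Vspace sqrtA u -> 0 < t <= T ->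
       `|B u| <= gamma t * Vnorm sqrtA u)
    (N : nat) (N_ge2 : (2 <= N)%N)
    (t : nat -> K) (t_grid : time_grid N T t)
    (f : K -> H) (U : nat -> H) (U_sol : bdf2_solution t ip sqrtA B f N U)
    (R : K) (R_bound : 1 < R < (3 + Num.sqrt 17) / 2)
    (r_bound : max_ratio t N <= R)
    (cR : K)
    (cR_bound : Num.max ((2 + 2 * R) / (2 + R))
                        ((2 + 2 * R) / (2 + 3 * R - R ^+ 2)) < cR)
    (c1 : K) (c1_bound : 0 < c1 < 1)
    (k_bound : cR * gmax ^+ 2 * max_step t N <= c1) :
  forall n : nat, (2 <= n <= N)%N ->
  let C2 := stab_const t cR c1 gamma n in
  [/\ R / (1 + R) * step t n * `|bdiff t U n| ^+ 2 + Vnorm sqrtA (U n) ^+ 2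
        <= C2 * (R / (1 + R) * step t 1 * `|bdiff t U 1| ^+ 2
                 + Vnorm sqrtA (U 1%N) ^+ 2
                 + cR * \sum_(2 <= j < n.+1) step t j * `|f (t j)| ^+ 2),
      \sum_(2 <= j < n.+1) step t j * Vnorm sqrtA (U j) ^+ 2
        <= C2 * t n * (step t 1 * `|bdiff t U 1| ^+ 2
                       + Vnorm sqrtA (U 1%N) ^+ 2
                       + cR * \sum_(2 <= j < n.+1)
                                step t j * `|f (t j)| ^+ 2) &
      C2 <= cR / (1 - c1) * expR (cR / (1 - c1) * gmax ^+ 2 * t n)].
Proof.
have /andP[c1_gt0 c1_lt1] := c1_bound.
have /andP[R_gt1 _] := R_bound.
have D_gt0 := bdf2_discriminant_gt0 R_bound.
have cR_gt1 : 1 < cR.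
  apply: le_lt_trans cR_bound; rewrite le_max; apply/orP; left.
  by rewrite ler_pdivlMr; lra.
have cR_gt0 : 0 < cR by exact: lt_trans cR_gt1.
have [t0 tN t_lt] := t_grid.
have k_gt0 n : (1 <= n <= N)%N -> 0 < step t n.
  by case: n => // n /andP[_ nN]; rewrite subr_gt0; exact: t_lt.
have t_le m n : (m <= n)%N -> (n <= N)%N -> t m <= t n.
  elim: n => [|n IH]; first by rewrite leqn0 => /eqP ->.
  rewrite leq_eqVlt => /predU1P[-> //|mn nN].
  by apply: (le_trans (IH mn (ltnW nN))); exact: ltW (t_lt _ nN).
have t_in n : (1 <= n <= N)%N -> 0 < t n <= T.
  move=> /andP[n1 nN]; rewrite -tN t_le // andbT -t0.
  apply: lt_le_trans (t_le _ _ n1 nN); exact: t_lt (leq_trans _ nN).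
have range1 n : (2 <= n <= N)%N -> (1 <= n <= N)%N by case/andP => /ltnW -> ->.
have range1p n : (2 <= n <= N)%N -> (1 <= n.-1 <= N)%N.
  by case: n => // n /andP[n1 /ltnW ->]; rewrite andbT.
have gamma_le n : (1 <= n <= N)%N -> gamma (t n) ^+ 2 <= gmax ^+ 2.
  move=> /t_in tn; have g0 := gamma_ge0 _ tn.
  have g_le : gamma (t n) <= gmax.
    by apply: gamma_max.2; exists (t n) => //=; rewrite in_itv.
  by rewrite ler_pXn2r // nnegrE // (le_trans g0).
have [U_V U_eq] := U_sol.
pose a j := cR * (gamma (t j) ^+ 2 * step t j).
pose F j := cR * (step t j * `|f (t j)| ^+ 2).
pose E := bdf2_energy t sqrtA U R.
have step_le j : (2 <= j <= N)%N ->
    [/\ 0 <= a j <= c1, 0 <= F j & E j <= E j.-1 + F j + a j * E j].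
  move=> jN; have k_ge0 := ltW (k_gt0 j (range1 j jN)); split.
  - apply/andP; split.
      exact: mulr_ge0 (ltW cR_gt0) (mulr_ge0 (sqr_ge0 _) k_ge0).
    (* The step-size restriction is what keeps [a j] below c1 < 1. *)
    apply: le_trans k_bound; rewrite /a -mulrA ler_pM2l //.
    rewrite ler_pM ?sqr_ge0 ?gamma_le ?range1 //.
    by apply: le_bigmax_seq => //; rewrite mem_index_iota ltnS.
  - exact: mulr_ge0 (ltW cR_gt0) (mulr_ge0 k_ge0 (sqr_ge0 _)).
  - apply: (bdf2_energy_step ip_norm R_bound cR_bound).
    + exact/k_gt0/range1.
    + exact/k_gt0/range1p.
    + apply: le_trans r_bound; apply: le_bigmax_seq => //.
      by rewrite mem_index_iota ltnS.
    + exact/U_V/range1.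
    + exact/U_V/range1p.
    + exact: B_bound (U_V _ (range1 _ jN)) (t_in _ (range1 _ jN)).
    + exact: U_eq.
have E_ge n : (1 <= n <= N)%N -> Vnorm sqrtA (U n) ^+ 2 <= E n.
  move=> nN; rewrite lerDr; apply: mulr_ge0 (sqr_ge0 _).
  by apply: mulr_ge0 (ltW (k_gt0 n nN)); rewrite divr_ge0; lra.
have E1_ge0 : 0 <= E 1%N.
  by apply: le_trans (E_ge _ _); rewrite ?sqr_ge0 // (leq_trans _ N_ge2).
have gronwall := discrete_gronwall c1_lt1 step_le E1_ge0.
(* Gronwall's inequality gives only the exponential; a prefactor of at least 1 may be added to reach
   [C2]. *)
have C_ge1 : 1 <= cR / (1 - c1).
  by rewrite ler_pdivlMr; lra.
move=> n n_range C2; have /andP[n2 nN] := n_range.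
pose G := E 1%N + cR * \sum_(2 <= j < n.+1) step t j * `|f (t j)| ^+ 2.
have sum_le (h : nat -> K) m :
    (forall j, (2 <= j <= N)%N -> 0 <= h j) -> (m <= n)%N ->
    \sum_(2 <= j < m.+1) h j <= \sum_(2 <= j < n.+1) h j.
  (* For m = 0 the left sum is empty, and the right one is nonnegative. *)
  move=> h_ge0 mn; have [m2|m2] := leqP 2 m.+1; last first.
    rewrite big_geq 1?ltnW // big_nat sumr_ge0 // => j /andP[j2 jn].
    by apply: h_ge0; rewrite j2 (leq_trans _ nN).
  rewrite (@big_cat_nat _ _ _ m.+1 2 n.+1) //= lerDl big_nat sumr_ge0 // => j.
  move=> /andP[mj jn]; apply: h_ge0.
  by rewrite (leq_trans m2) // (leq_trans _ nN).
have sum_step : \sum_(2 <= j < n.+1) step t j <= t n.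
  have -> : \sum_(2 <= j < n.+1) step t j = t n - t 1%N.
    by rewrite big_add1 -(telescope_sumr t (ltnW n2)).
  by rewrite gerBl -t0 t_le // (leq_trans _ N_ge2).
(* The bound is uniform in [m]: m = n is the first claim, and m = 2, ..., n supply the summands of
   the second. *)
have E_le m : (1 <= m <= n)%N -> E m <= C2 * G.
  move=> /andP[m1 mn]; apply: (le_trans (gronwall m _)).
    by rewrite m1 (leq_trans mn).
  apply: ler_pM.
  - exact: expR_ge0.
  - rewrite addr_ge0 // big_nat sumr_ge0 // => j /andP[j2 jm].
    by have [] := step_le j; rewrite // j2 (leq_trans _ (leq_trans mn nN)).
  - rewrite /C2 /stab_const -[leLHS]mul1r ler_pM ?expR_ge0 // ler_expR.
    rewrite -mulr_sumr mulrA [_^-1 * _]mulrC ler_wpM2l ?(le_trans ler01) //.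
    apply: sum_le => // j jN.
    by rewrite mulr_ge0 ?sqr_ge0 ?(ltW (k_gt0 j _)) ?range1.
  - rewrite lerD2l -mulr_sumr ler_pM2l //; apply: sum_le => // j jN.
    by rewrite mulr_ge0 ?sqr_ge0 ?(ltW (k_gt0 j _)) ?range1.
(* The second claim has weight 1 on the starting quotient, and R / (1 + R) <= 1. *)
have G_le : G <= step t 1 * `|bdiff t U 1| ^+ 2 + Vnorm sqrtA (U 1%N) ^+ 2
    + cR * \sum_(2 <= j < n.+1) step t j * `|f (t j)| ^+ 2.
  rewrite !lerD2r -mulrA ler_piMl //.
    by rewrite mulr_ge0 ?sqr_ge0 // ltW // k_gt0 // (leq_trans _ N_ge2).
  by rewrite ler_pdivrMr; lra.
have C2_ge0 : 0 <= C2 by rewrite mulr_ge0 ?expR_ge0 // (le_trans ler01).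
have tn_ge0 : 0 <= t n by rewrite -t0 t_le.
split.
- by apply: E_le; rewrite (ltnW n2) /=.
- rewrite mulrAC; apply: (@le_trans _ _ (C2 * G * t n)).
    apply: (@le_trans _ _ (C2 * G * \sum_(2 <= j < n.+1) step t j)).
      rewrite mulr_sumr; apply: ler_sum_nat => j /andP[j2 jn].
      have jN : (1 <= j <= N)%N by rewrite (ltnW j2) (leq_trans _ nN).
      rewrite mulrC ler_wpM2r ?(ltW (k_gt0 j jN)) //.
      by apply: (le_trans (E_ge j jN)); apply: E_le; rewrite (ltnW j2).
    apply: ler_wpM2l sum_step; apply: (le_trans E1_ge0).
    by apply: E_le; rewrite (ltnW n2).
  by rewrite ler_wpM2r // ler_wpM2l.
- rewrite ler_wpM2l ?(le_trans ler01) // ler_expR -[leRHS]mulrA.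
  rewrite ler_wpM2l ?(le_trans ler01) //.
  apply: (@le_trans _ _ (gmax ^+ 2 * \sum_(2 <= j < n.+1) step t j)).
    rewrite mulr_sumr; apply: ler_sum_nat => j /andP[j2 jn].
    have jN : (1 <= j <= N)%N by rewrite (ltnW j2) (leq_trans _ nN).
    by rewrite ler_wpM2r ?(ltW (k_gt0 j jN)) // gamma_le.
  by rewrite ler_wpM2l ?sqr_ge0.
Qed.
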